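(* Every integral ring satisfies the Köthe conjecture. That is: if $R$ is a ring such that every element of $R$ is integral over $\mathbb{Z}$, then every nil one-sided ideal of $R$ is contained in a nil two-sided ideal of $R$.
   Context: Rings are associative, possibly nonunital and noncommutative. An element $a$ of a ring $R$ is integral (over $\mathbb{Z}$) if there is a monic polynomial $p\in\mathbb{Z}[x]$ with $p(0)=0$ and $p(a)=0$; $R$ is integral if all its elements are. A subset of $R$ is nil if all its elements are nilpotent. A ring $R$ is said to satisfy the Köthe conjecture if every nil one-sided ideal of $R$ is contained in a nil two-sided ideal of $R$. *)

(* Defs.v *)
From HB Require Import structures.
From mathcomp Require Import all_boot all_order all_algebra.
From mathcomp Require Import boolp classical_sets.

Set Implicit Arguments.
Unset Strict Implicit.
Unset Printing Implicit Defensive.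

Import GRing.Theory.

Local Open Scope classical_set_scope.
Local Open Scope ring_scope.

(* Associative rings, not assumed to have a unit or to be commutative: the
   addition is that of zmodType (in %R), the multiplication is that of
   semigroupType (in %g).  Every MathComp ring (pzRingType) assumes a unit. *)
HB.mixin Record isDistributive R of GRing.Zmodule R & Semigroup R := {
  nu_mulDl : @left_distributive R R *%g +%R;
  nu_mulDr : @right_distributive R R *%g +%R
}.

#[short(type="nonUnitalRingType")]
HB.structure Definition NonUnitalRing :=
  { R of GRing.Zmodule R & Semigroup R & isDistributive R }.

Section Definitions.
Variable R : nonUnitalRingType.

(* With no unit only positive powers make sense: powS a n is a ^ (n + 1). *)
Definition powS (a : R) (n : nat) : R := iter n (fun x : R => (a * x)%g) a.

(* The value at a of a polynomial p without constant term; the coefficient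
   p`_0 is ignored, so this is meaningful only when p.[0] = 0. *)
Definition nu_eval (p : {poly int}) (a : R) : R :=
  \sum_(i < (size p).-1) powS a i *~ p`_i.+1.

Definition integral_elt (a : R) : Prop :=
  exists p : {poly int}, [/\ p \is monic, p.[0] = 0 & nu_eval p a = 0].

Definition nilpotent_elt (a : R) : Prop := exists n : nat, powS a n = 0.

Definition nil_subset (A : set R) : Prop := forall a, A a -> nilpotent_elt a.

Definition additive_subgroup (I : set R) : Prop :=
  I 0 /\ forall x y, I x -> I y -> I (x - y).

Definition left_ideal (I : set R) : Prop :=
  additive_subgroup I /\ forall r x : R, I x -> I (r * x)%g.

Definition right_ideal (I : set R) : Prop :=
  additive_subgroup I /\ forall r x : R, I x -> I (x * r)%g.

Definition one_sided_ideal (I : set R) : Prop := left_ideal I \/ right_ideal I.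

Definition two_sided_ideal (I : set R) : Prop := left_ideal I /\ right_ideal I.

End Definitions.

Definition integral_ring (R : nonUnitalRingType) : Prop :=
  forall a : R, integral_elt a.

Definition Koethe (R : nonUnitalRingType) : Prop :=
  forall I : set R, one_sided_ideal I -> nil_subset I ->
    exists J : set R, [/\ two_sided_ideal J, nil_subset J & I `<=` J].

(* Main.v *)
(* The Jacobson radical contains every nil one-sided ideal, so it suffices that
   in an integral ring R it is nil.  We work in S = Z + R.  Let a in R lie in
   the radical of S, with p(a) = 0, p = X^k (c + X g) and c <> 0.  Then
   b = g(a) a acts on a^k as -c, so the unit 1 - 2 c b acts on a^k as the
   integer d = 1 + 2 c^2 > 1.  Its inverse belongs to 1 + R, hence is integral,
   and clearing the denominators d yields N a^k = 0 for an integer N = 1 mod d.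
   Therefore the powers of a take finitely many values, a^i = a^(i + j) with
   j > 0, and since 1 - a^j is a unit, a^i = 0. *)
From HB Require Import structures.
From mathcomp Require Import all_boot all_order all_algebra.
From mathcomp Require Import classical_sets.
Require Import Defs.

Set Implicit Arguments.
Unset Strict Implicit.
Unset Printing Implicit Defensive.

Import Order.TTheory GRing.Theory Num.Theory.

Local Open Scope ring_scope.

(** * The Jacobson radical of a unital ring, by quasi-regularity *)

Section JacobsonRadical.
Variable S : pzRingType.
Implicit Types a b s u w x : S.

Definition invertible w := exists u, u * w = 1 /\ w * u = 1.

(** The elementwise form of the radical, with two-sided inverses, avoids maximal ideals and matches
    how nil ideals enter it. *)
Definition jacobson a := forall s, invertible (1 + s * a).

Lemma invertibleM u w : invertible u -> invertible w -> invertible (u * w).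
Proof.
move=> [u' [u'u uu']] [w' [w'w ww']]; exists (w' * u'); split.
  by rewrite mulrA -(mulrA w') u'u mulr1.
by rewrite mulrA -(mulrA u) ww' mulr1.
Qed.

(** If [u] inverts [1 + a * b], then [1 - b * u * a] inverts [1 + b * a]. This makes the left-handed
    definition of [jacobson] symmetric. *)
Lemma invertible_swap a b : invertible (1 + a * b) -> invertible (1 + b * a).
Proof.
move=> [u [uab abu]]; exists (1 - b * u * a); split.
  have -> : (1 - b * u * a) * (1 + b * a) =
      1 + b * a - b * (u * (1 + a * b)) * a.
    by rewrite mulrBl mul1r !mulrDr !mulr1 mulrDl !mulrA.
  by rewrite uab mulr1 addrK.
have -> : (1 + b * a) * (1 - b * u * a) =
    1 + b * a - b * ((1 + a * b) * u) * a.
  by rewrite mulrBr mulr1 !mulrDl !mul1r mulrDr mulrDl !mulrA.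
by rewrite abu mulr1 addrK.
Qed.

Lemma invertible_1Dnilp x n : x ^+ n = 0 -> invertible (1 + x).
Proof.
move=> xn0; exists (\sum_(i < n) (- x) ^+ i).
have E : (1 + x) * (\sum_(i < n) (- x) ^+ i) = 1.
  have := subrX1 (- x) n; rewrite exprNn xn0 mulr0 sub0r -opprD mulNr.
  by move/oppr_inj; rewrite addrC => <-.
split=> //; rewrite -[RHS]E; apply/esym/commr_sum => i _.
by apply/commrX/commrN/commr_sym/commrD; [exact: commr1 | exact: commr_refl].
Qed.

Lemma jacobson0 : jacobson 0.
Proof. by move=> s; rewrite mulr0 addr0; exists 1; rewrite mulr1. Qed.

Lemma jacobsonD a b : jacobson a -> jacobson b -> jacobson (a + b).
Proof.
move=> Ja Jb s; have [u [uw wu]] := Ja s.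
(* As [u] inverts [1 + s * a], the term [s * b] is [(1 + s * a) * (u * s * b)]. *)
have -> : 1 + s * (a + b) = (1 + s * a) * (1 + u * s * b).
  by rewrite [RHS]mulrDr mulr1 !mulrA wu mul1r mulrDr addrA.
by apply: invertibleM; [exact: Ja | exact: Jb].
Qed.

Lemma jacobsonMl r a : jacobson a -> jacobson (r * a).
Proof. by move=> Ja s; rewrite mulrA. Qed.

Lemma jacobsonMr r a : jacobson a -> jacobson (a * r).
Proof.
by move=> Ja s; rewrite mulrA; apply: invertible_swap; rewrite mulrA; apply: Ja.
Qed.

Lemma jacobsonB a b : jacobson a -> jacobson b -> jacobson (a - b).
Proof.
by move=> Ja Jb; apply: jacobsonD => //; rewrite -mulN1r; apply: jacobsonMl.
Qed.

End JacobsonRadical.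

(** * Integer polynomials evaluated in a noncommutative ring *)

Section IntegerPolynomialEvaluation.
Variable S : nzRingType.
Implicit Types a u : S.

(** Integers are central, so evaluation at [a] is a ring morphism even when the target is not
    commutative. *)
Fact commr_intr a : commr_rmorph (intr : int -> S) a.
Proof. by move=> z; apply: commr_int. Qed.

Definition ieval a : {rmorphism {poly int} -> S} := horner_morph (commr_intr a).

Lemma ievalX a : ieval a 'X = a. Proof. exact: horner_morphX. Qed.

Lemma ievalC a c : ieval a c%:P = c%:~R. Proof. exact: horner_morphC. Qed.

Lemma ieval_sum a (p : {poly int}) n : (size p <= n)%N ->
  ieval a p = \sum_(i < n) (p`_i)%:~R * a ^+ i.
Proof.
move=> le_pn; rewrite [LHS](@horner_coef_wide _ n).
  by apply: eq_bigr => i _; rewrite coef_map.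
exact: leq_trans (size_poly _ _) le_pn.
Qed.

Lemma ieval_comp a (p q : {poly int}) : ieval a (p \Po q) = ieval (ieval a q) p.
Proof.
rewrite comp_polyE rmorph_sum (ieval_sum _ (leqnn _)).
by apply: eq_bigr => i _; rewrite -mul_polyC rmorphM /= ievalC rmorphXn.
Qed.

(* Multiplying p(u) = 0 by w and d^(deg p) turns each u^i into d^(deg p - i),
   which leaves an integer congruent to 1 modulo d, hence nonzero. *)
Lemma integral_inverse_torsion (p : {poly int}) (d : int) u w :
    p \is monic -> ieval u p = 0 -> (1 < d)%R -> w = d%:~R * (w * u) ->
  exists2 N : int, N != 0 & N%:~R * w = 0.
Proof.
move=> p_mon pu0 d_gt1 w_eq.
have wi i : d%:~R ^+ i * (w * u ^+ i) = w.
  elim: i => [|i IHi]; first by rewrite !expr0 mul1r mulr1.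
  by rewrite [X in _ = X]w_eq -[in RHS]IHi exprS exprSr !mulrA.
pose n := (size p).-1.
have szp : size p = n.+1 by rewrite prednK // size_poly_gt0 monic_neq0.
exists (\sum_(i < n.+1) p`_i * d ^+ (n - i)).
  rewrite big_ord_recr /= subnn expr0 mulr1.
  have -> : p`_n = 1 by rewrite -/(lead_coef p) (monicP p_mon).
  apply/eqP => E.
  have : (d %| - \sum_(i < n) p`_i * d ^+ (n - i))%Z.
    rewrite rpredN; apply: rpred_sum => i _.
    by rewrite dvdz_mull // -(@prednK (n - i)) ?subn_gt0 // exprS dvdz_mulr.
  have -> : - \sum_(i < n) p`_i * d ^+ (n - i) = 1.
    by apply/eqP; rewrite eq_sym -subr_eq0 opprK addrC E.
  rewrite dvdz1 => /eqP d1; move: (ltW (lt_trans ltr01 d_gt1)) => /gez0_abs.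
  by rewrite d1 => dE; rewrite -dE in d_gt1.
transitivity (d%:~R ^+ n * (w * ieval u p)); last by rewrite pu0 !mulr0.
rewrite (@ieval_sum _ _ n.+1) ?szp // rmorph_sum mulr_suml !mulr_sumr.
apply: eq_bigr => i _; rewrite -{1}(wi i) rmorphM rmorphXn /=.
have le_in : (i <= n)%N by rewrite -ltnS.
rewrite !mulrA -(mulrA _ (_ ^+ (n - i))) -exprD subnK //.
rewrite -[_ * (p`_i)%:~R]mulrA.
rewrite [w * (p`_i)%:~R]commr_int mulrA.
by rewrite [_ ^+ n * (p`_i)%:~R]commr_int.
Qed.

(* The additive group generated by the powers a^(i + k) is finitely generated
   and killed by N, hence finite. *)
Lemma torsion_pow_period (p : {poly int}) (N : int) k a :
    p \is monic -> ieval a p = 0 -> N != 0 -> N%:~R * a ^+ k = 0 ->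
  exists i j, a ^+ (i + j.+1) = a ^+ i.
Proof.
move=> p_mon pa0 N0 Nak.
pose n := size p; pose m := `|N|%N.
pose r i := Pdiv.Ring.rmodp 'X^i p.
have szr i : (size (r i) <= n)%N.
  by apply/ltnW/Pdiv.Ring.ltn_rmodpN0/monic_neq0.
have evr i : a ^+ i = ieval a (r i).
  rewrite -{1}(ievalX a) -rmorphXn /=.
  rewrite [in LHS](Pdiv.RingMonic.rdivp_eq p_mon 'X^i).
  by rewrite rmorphD rmorphM /= pa0 mulr0 add0r.
have modN z : z%:~R * a ^+ k = (z %% N)%Z%:~R * a ^+ k.
  by rewrite {1}(divz_eq z N) rmorphD rmorphM /= mulrDl -mulrA Nak mulr0 add0r.
pose T := {ffun 'I_n -> 'I_m}.
have ltm z : (`|(z %% N)%Z| < m)%N.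
  by rewrite -ltz_nat gez0_abs ?modz_ge0 // /m abszE ltz_mod.
(* Pigeonhole: [f] records the coefficients modulo [N] of the remainder of ['X^i] by [p], and has
   one more argument than [T] has elements. *)
pose f (i : 'I_(#|{: T}|.+1)) : T := [ffun j : 'I_n => Ordinal (ltm (r i)`_j)].
have /injectivePn[i1 [i2 ne_i fE]] : ~~ injectiveb f.
  by apply/negP => /injectiveP /leq_card; rewrite card_ord ltnn.
have E : a ^+ (i1 + k) = a ^+ (i2 + k).
  rewrite !exprD (evr i1) (evr i2) !(ieval_sum _ (szr _)) !mulr_suml.
  apply: eq_bigr => j _.
  have /(congr1 val) /= := congr1 (fun g : T => g j) fE.
  rewrite !ffunE /= => eqj.
  rewrite -!mulrA -!exprD (addnC j) exprD !mulrA modN [in RHS]modN.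
  congr (_%:~R * _ * _).
  by rewrite -[LHS]gez0_abs ?modz_ge0 // eqj gez0_abs ?modz_ge0.
wlog lt_i : i1 i2 ne_i fE E / (i1 < i2)%N.
  move=> W; case: (ltngtP i1 i2) => [|lt|/val_inj eq_i]; first exact: (W i1 i2).
    by apply: (W i2 i1) => //; rewrite eq_sym.
  by rewrite eq_i eqxx in ne_i.
exists (i1 + k)%N, (i2 - i1).-1.
by rewrite prednK ?subn_gt0 // addnAC subnKC ?E // ltnW.
Qed.

End IntegerPolynomialEvaluation.

(** * The unitization Z + R *)

Section Unitization.
Variable R : nonUnitalRingType.
Implicit Types a b x y : R.

(** Naming the two translations lets them be declared additive, which yields compatibility with
    integer multiples. *)
Definition nu_mull x y := (x * y)%g.
Definition nu_mulr x y := (y * x)%g.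

Fact nu_mull_is_zmod_morphism x : zmod_morphism (nu_mull x).
Proof.
by move=> y z; apply/eqP; rewrite eq_sym subr_eq -[X in _ == X]nu_mulDr subrK.
Qed.

Fact nu_mulr_is_zmod_morphism x : zmod_morphism (nu_mulr x).
Proof.
by move=> y z; apply/eqP; rewrite eq_sym subr_eq -[X in _ == X]nu_mulDl subrK.
Qed.

HB.instance Definition _ x :=
  GRing.isZmodMorphism.Build R R (nu_mull x) (nu_mull_is_zmod_morphism x).
HB.instance Definition _ x :=
  GRing.isZmodMorphism.Build R R (nu_mulr x) (nu_mulr_is_zmod_morphism x).

Lemma nu_mulrzr x y n : (x * (y *~ n))%g = (x * y)%g *~ n.
Proof. exact: (raddfMz (nu_mull x)). Qed.

Lemma nu_mulrzl x y n : ((x *~ n) * y)%g = (x * y)%g *~ n.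
Proof. exact: (raddfMz (nu_mulr y)). Qed.

Definition unitization : Type := (int * R)%type.
HB.instance Definition _ := GRing.Zmodule.on unitization.

(** The Dorroh extension: [(m, x)] stands for m + x, and the product is expanded by
    distributivity. *)
Definition unitization_mul (s t : unitization) : unitization :=
  (s.1 * t.1, t.2 *~ s.1 + s.2 *~ t.1 + (s.2 * t.2)%g).

Fact unitization_mulA : associative unitization_mul.
Proof.
move=> [m x] [n y] [k z]; congr (_, _) => /=; first by rewrite mulrA.
rewrite !nu_mulDl !nu_mulDr !mulrzDl !nu_mulrzr !nu_mulrzl -!mulrzA mulgA.
by rewrite (mulrC n m) (mulrC k m) [LHS](AC (4*3) ((1*(2*4*6))*(3*5*7))).
Qed.

Fact unitization_mul1 : left_id ((1, 0) : unitization) unitization_mul.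
Proof.
move=> [m x]; rewrite /unitization_mul /= mul1r mulr1z mul0rz addr0.
by rewrite -[X in (X * x)%g](mulr0z x) nu_mulrzl mulr0z addr0.
Qed.

Fact unitization_1mul : right_id ((1, 0) : unitization) unitization_mul.
Proof.
move=> [m x]; rewrite /unitization_mul /= mulr1 mulr1z mul0rz add0r.
by rewrite -[X in (x * X)%g](mulr0z x) nu_mulrzr mulr0z addr0.
Qed.

Fact unitization_mulDl : left_distributive unitization_mul +%R.
Proof.
move=> [m x] [n y] [k z]; congr (_, _) => /=; first by rewrite mulrDl.
by rewrite nu_mulDl mulrzDl mulrzDr [X in X + _ = _]addrACA [LHS]addrACA.
Qed.

Fact unitization_mulDr : right_distributive unitization_mul +%R.
Proof.
move=> [m x] [n y] [k z]; congr (_, _) => /=; first by rewrite mulrDr.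
by rewrite nu_mulDr mulrzDl mulrzDr [X in X + _ = _]addrACA [LHS]addrACA.
Qed.

Fact unitization_1neq0 : ((1, 0) : unitization) != 0.
Proof. by []. Qed.

HB.instance Definition _ := GRing.Zmodule_isNzRing.Build unitization
  unitization_mulA unitization_mul1 unitization_1mul
  unitization_mulDl unitization_mulDr unitization_1neq0.

Definition unitize (a : R) : unitization := (0, a).

Fact unitize_is_zmod_morphism : zmod_morphism unitize.
Proof. by move=> a b; rewrite /unitize; congr (_, _). Qed.

HB.instance Definition _ :=
  GRing.isZmodMorphism.Build R unitization unitize unitize_is_zmod_morphism.

Lemma unitize_inj : injective unitize.
Proof. by move=> a b []. Qed.

Lemma unitizeM a b : unitize (a * b)%g = unitize a * unitize b.
Proof. by congr (_, _); rewrite /= !mulr0z !add0r. Qed.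

Lemma unitizeX a n : unitize (powS a n) = unitize a ^+ n.+1.
Proof. by elim: n => [|n IHn] //; rewrite exprS -IHn -unitizeM. Qed.

Lemma unitizeMz a n : unitize (a *~ n) = n%:~R * unitize a.
Proof. by rewrite raddfMz mulrzl. Qed.

Lemma unitization_mul_unitize (s : unitization) a :
  s * unitize a = unitize (a *~ s.1 + (s.2 * a)%g).
Proof. by congr (_, _); rewrite /= ?mulr0 // mulr0z addr0. Qed.

Lemma unitize_mul_unitization (s : unitization) a :
  unitize a * s = unitize (a *~ s.1 + (a * s.2)%g).
Proof. by congr (_, _); rewrite /= ?mul0r // mulr0z add0r. Qed.

Lemma ieval_unitize (p : {poly int}) a :
  p.[0] = 0 -> ieval (unitize a) p = unitize (nu_eval p a).
Proof.
rewrite horner_coef0 => p00.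
case sz: (size p) => [|n].
  move/eqP: sz; rewrite size_poly_eq0 => /eqP ->.
  by rewrite /nu_eval size_poly0 big_ord0 !raddf0.
rewrite (@ieval_sum _ _ _ n.+1) ?sz // big_ord_recl p00 mul0r add0r.
rewrite /nu_eval sz raddf_sum; apply: eq_bigr => i _.
by rewrite /= unitizeMz unitizeX.
Qed.

Lemma nilpotent_eltP a :
  nilpotent_elt a <-> exists n, unitize a ^+ n = 0.
Proof.
split=> [[n an0]|[[|n]]]; first by exists n.+1; rewrite -unitizeX an0 raddf0.
  (* Exponent 0 has no counterpart in [powS]; it is excluded because 1 is nonzero in the
     unitization. *)
  by move/eqP; rewrite expr0 oner_eq0.
by rewrite -unitizeX => an0; exists n; apply: unitize_inj; rewrite an0 raddf0.
Qed.

End Unitization.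

(** * The radical of an integral ring is nil *)

Section IntegralRing.
Variable R : nonUnitalRingType.
Hypothesis R_integral : integral_ring R.

(** Write u = 1 + x with x in R: if p kills x, then the monic polynomial p(X - 1) kills u. *)
Lemma unitization_unipotent_integral (u : unitization R) : u.1 = 1 ->
  exists2 p : {poly int}, p \is monic & ieval u p = 0.
Proof.
move=> u1; have [p [p_mon p0 pu0]] := R_integral u.2.
exists (p \Po ('X - 1%:P)).
  by rewrite monicE lead_coef_comp ?size_XsubC // lead_coefXsubC expr1n mulr1.
rewrite ieval_comp rmorphB /= ievalX ievalC.
have -> : u - 1%:~R = unitize u.2 by congr (_, _); rewrite /= ?u1 ?subrr ?subr0.
by rewrite ieval_unitize // pu0 raddf0.
Qed.

Lemma jacobson_pow_torsion (a : R) : jacobson (unitize a) ->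
  exists k, exists2 N : int, N != 0 & N%:~R * unitize a ^+ k = 0.
Proof.
move=> Ja; have [p [p_mon p0 pa0]] := R_integral a.
(* Taking for [k] the multiplicity of the root 0 makes the constant term [c] of the cofactor
   nonzero. *)
have [k [q q0 Ep]] := multiplicity_XsubC p 0.
rewrite monic_neq0 //= in q0.
have /factor_theorem[g Eq] : root (q - q.[0]%:P) 0.
  by rewrite /root !hornerE subrr.
set c := q.[0] in q0 Eq; set A := unitize a in Ja *.
pose b := ieval A g * A.
have Eb : A ^+ k * b = - c%:~R * A ^+ k.
  have : ieval A p = 0 by rewrite ieval_unitize // pa0 raddf0.
  rewrite Ep -(subrK c%:P q) Eq subr0 mulrC rmorphM rmorphXn rmorphD rmorphM /=.
  rewrite ievalX ievalC mulrDr commr_int => /eqP.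
  by rewrite addr_eq0 mulNr => /eqP.
(* With this [s], [1 + s * A] is 1 - 2cb. The factor c turns the eigenvalue -c of b into a square,
   so d > 1 for either sign of c. *)
pose d : int := 1 + 2 * c ^+ 2; pose s := (- 2 * c)%:~R * ieval A g.
have [u [uf fu]] := Ja s.
(* The integer component of [s * A] is 0, so that of its quasi-inverse [u] is forced to be 1. *)
have u1 : u.1 = 1.
  have : u.1 * (1 + s.1 * 0) = 1 by exact: (congr1 fst uf).
  by rewrite mulr0 addr0 mulr1.
have [p' p'_mon p'u0] := unitization_unipotent_integral u1.
exists k; apply: (integral_inverse_torsion p'_mon p'u0 (d := d)).
  by rewrite ltrDl mulr_gt0 // exprn_even_gt0.
have Ef : A ^+ k * (1 + s * A) = d%:~R * A ^+ k.
  rewrite mulrDr mulr1 -mulrA -/b mulrA commr_int -mulrA Eb mulrA.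
  rewrite -rmorphN -rmorphM /= [d%:~R]rmorphD /= mulrDl mul1r.
  by congr (_ + _%:~R * _); rewrite !mulNr mulrN opprK -mulrA.
by rewrite mulrA -Ef -mulrA fu mulr1.
Qed.

Lemma jacobson_nilpotent (a : R) : jacobson (unitize a) -> nilpotent_elt a.
Proof.
move=> Ja; have [k [N N0 Nak]] := jacobson_pow_torsion Ja.
have [p [p_mon p0 pa0]] := R_integral a.
have pA0 : ieval (unitize a) p = 0 by rewrite ieval_unitize // pa0 raddf0.
have [i [j E]] := torsion_pow_period p_mon pA0 N0 Nak.
apply/nilpotent_eltP; exists i.
(* This multiplier makes 1 - a^(j + 1) invertible, and a^i annihilates it by periodicity. *)
have [u [_ vu]] := Ja (- unitize a ^+ j).
rewrite -[LHS]mulr1 -vu mulrA mulNr -exprSr mulrBr mulr1 -exprD E subrr.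
by rewrite mul0r.
Qed.

End IntegralRing.

(** * Nil one-sided ideals and the conclusion *)

Lemma additive_subgroupD (R : nonUnitalRingType) (I : set R) x y :
  additive_subgroup I -> I x -> I y -> I (x + y).
Proof.
move=> [I0 IB] Ix Iy; rewrite -[y]opprK; apply: (IB) => //.
by rewrite -sub0r; apply: IB.
Qed.

Lemma additive_subgroupMz (R : nonUnitalRingType) (I : set R) x (n : int) :
  additive_subgroup I -> I x -> I (x *~ n).
Proof.
move=> Isub Ix.
have In m : I (x *+ m).
  elim: m => [|m IHm]; first by rewrite mulr0n; case: Isub.
  by rewrite mulrS; apply: additive_subgroupD.
case: n => m; first exact: In.
by rewrite NegzE mulrNz -sub0r; case: Isub => I0; apply => //; apply: In.
Qed.

(** For a left ideal, [s * unitize a] comes from an element of [I], hence is nilpotent. For a right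
    ideal this holds of [unitize a * s], and [invertible_swap] exchanges the factors. *)
Lemma nil_one_sided_jacobson (R : nonUnitalRingType) (I : set R) a :
  one_sided_ideal I -> nil_subset I -> I a -> jacobson (unitize a).
Proof.
move=> I1 Inil Ia s.
have inv1D x : I x -> invertible (1 + unitize x).
  by move=> /Inil/nilpotent_eltP[n]; apply: invertible_1Dnilp.
case: I1 => [[Isub IM]|[Isub IM]].
  rewrite unitization_mul_unitize; apply: inv1D.
  by apply: additive_subgroupD => //; [exact: additive_subgroupMz | exact: IM].
apply: invertible_swap; rewrite unitize_mul_unitization; apply: inv1D.
by apply: additive_subgroupD => //; [exact: additive_subgroupMz | exact: IM].
Qed.

Theorem corollary3p15 (R : nonUnitalRingType) : integral_ring R -> Koethe R.
Proof.
(* One ideal serves every [I]: the trace on R of the radical of its unitization. *)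
move=> R_int I I1 Inil; exists (fun a => jacobson (unitize a)).
have Jsub : additive_subgroup (fun a : R => jacobson (unitize a)).
  split=> [|x y Jx Jy]; first by rewrite raddf0; apply: jacobson0.
  by rewrite raddfB; apply: jacobsonB.
split; last by move=> a; apply: nil_one_sided_jacobson.
  split; split=> // r x Jx; rewrite unitizeM; first exact: jacobsonMl.
  exact: jacobsonMr.
by move=> a; apply: jacobson_nilpotent.
Qed.
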